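(* Fix real constants $0<C_1<C_2$ and let $0<\varepsilon<1/2$. Then there exist infinitely many triples $(a,b,n)\in\mathbb{N}^3$ with $\varepsilon n\le a\le(1-\varepsilon)n$ and $\varepsilon n\le b\le(1-\varepsilon)n$ such that \[ a!\,b!\ \mid\ n!\,(a+b-n)!\qquad\text{and}\qquad C_1\log n< a+b-n< C_2\log n . \]
   Context: $\log$ denotes the natural logarithm. *)

(* Defs.v *)
From mathcomp Require Import all_boot all_order all_algebra.
From mathcomp Require Import all_classical reals exp.

(* Main.v *)
Require Import Defs.
From mathcomp Require Import all_boot all_order all_algebra.
From mathcomp Require Import all_classical reals exp.
From mathcomp Require Import zify ring lra.
Import Order.TTheory GRing.Theory Num.Theory.
Set Implicit Arguments.
Unset Strict Implicit.
Unset Printing Implicit Defensive.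

(** Take [n = 2m], [a = m], [b = m + k] with [2k <= 2^t]. By Legendre, a prime
    [p] is harmless if the carries of [m + m] in base [p] outnumber those of
    [m + k]. Where [p^i > 2k], a carry of [m + k] forces one of [m + m], so
    only the at most [t] exponents with [p^i <= 2k] (hence only primes [p <=
    2^t]) can hurt. These are compensated if [m] has at least [3t]
    base-[p^2] digits [x] with [p^2 / 2 <= x <= p^2 - 2]: each one produces
    a carry of [m + m] but, once its position exceeds the size of [k], none
    of [m + k]. A random digit has this property with probability at least
    1/4, and an exponential moment bound shows that, among the [m] in [[2^s,
    2^(s+1))] with [s] quadratic in [t], fewer than [2^s] fail for some
    prime [p <= 2^t]. As [2^t] beats every multiple of [s], any [k] of order
    [log n] is allowed. *)

(** * Carries of [m + m] against carries of [m + k] *)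

(** [m.*2 %/ P - (m %/ P).*2] and [(m + k) %/ P - m %/ P - k %/ P] are the carries past [P], each 0
    or 1. *)
Lemma div_carry_le m k P : 0 < P ->
  m %/ P + (m + k) %/ P <= m.*2 %/ P + k %/ P + 1.
Proof. 
move=> P0; have := divn_eq m P; have := divn_eq k P; have := ltn_pmod m P0.
have := ltn_pmod k P0.
move: (m %/ P) (m %% P) (k %/ P) (k %% P) => u r v z zP rP ke me.
have h1: (m + k) %/ P < u + v + 2 by rewrite ltn_divLR //; nia.
have h2: u.*2 <= m.*2 %/ P by rewrite leq_divRL //; nia.
lia.
Qed.

(** A carry of [m + k] needs [m %% P >= P - k], which exceeds [P / 2], so [m + m] carries too. *)
Lemma div_no_carry_le m k P : k.*2 < P ->
  m %/ P + (m + k) %/ P <= m.*2 %/ P + k %/ P.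
Proof.
move=> kP; have P0 : 0 < P by lia.
have := divn_eq m P; have := ltn_pmod m P0.
move: (m %/ P) (m %% P) => u r rP me.
case: (ltnP (r + k) P) => h.
  have h1: (m + k) %/ P < u + 1 by rewrite ltn_divLR //; nia.
  have h2: u.*2 <= m.*2 %/ P by rewrite leq_divRL //; nia.
  by move: (m.*2 %/ P) ((m + k) %/ P) (k %/ P) h1 h2; clear => ? ? ? ? ?; lia.
have h1: (m + k) %/ P < u + 2 by rewrite ltn_divLR //; nia.
have h2: u.*2.+1 <= m.*2 %/ P by rewrite leq_divRL //; nia.
by move: (m.*2 %/ P) ((m + k) %/ P) (k %/ P) h1 h2; clear => ? ? ? ? ?; lia.
Qed.

(** The first bound makes [m + m] carry; the second leaves one unit for the lower digits and one for
    [k]. Bases 2 and 3 have no such digit, which is why base [p ^ 2] is used later. *)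
Definition good_digit (q x : nat) := (q <= x.*2) && (x + 2 <= q).

Lemma div_good_digit_lt m k q Q : 0 < q -> k <= Q -> 0 < Q ->
  good_digit q ((m %/ Q) %% q) ->
  m %/ (Q * q) + (m + k) %/ (Q * q) < m.*2 %/ (Q * q) + k %/ (Q * q).
Proof.
move=> q0 kQ Q0 /andP[].
rewrite divnMA; have := divn_eq m Q; have := ltn_pmod m Q0.
have := divn_eq (m %/ Q) q.
move: (m %% Q) (m %/ Q) (m %/ Q %% q) (m %/ Q %/ q) => r y x u ye rQ me h1 h2.
have P0 : 0 < Q * q by rewrite muln_gt0 Q0.
have mE : m = u * (Q * q) + (x * Q + r).
  by rewrite me ye mulnDl addnA -mulnA (mulnC q).
clear me ye.
have xQ : (x + 2) * Q <= Q * q by rewrite mulnC leq_mul2l h2 orbT.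
have xQ2 : Q * q <= x.*2 * Q by rewrite mulnC leq_mul2r h1 orbT.
have hA: (m + k) %/ (Q * q) < u + 1 by rewrite ltn_divLR //; nia.
have hB: u.*2.+1 <= m.*2 %/ (Q * q) by rewrite leq_divRL //; nia.
by move: (m.*2 %/ (Q * q)) ((m + k) %/ (Q * q)) (k %/ (Q * q)) hA hB;
  clear => ? ? ? ? ?; lia.
Qed.

(** * Comparison of [p]-adic valuations *)

(** A common range [N] lets the four factorials be compared term by term; the added quotients vanish
    since [n <= i < p ^ i.+1]. *)
Lemma logn_fact_sum p n N : prime p -> n <= N ->
  logn p n`! = \sum_(i < N) n %/ p ^ i.+1.
Proof.
move=> pp nN; rewrite logn_fact // big_add1 /= big_mkord.
rewrite (big_ord_widen N (fun i => n %/ p ^ i.+1)) // big_mkcond /=.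
apply: eq_bigr => i _; case: ltnP => // ni; rewrite divn_small //.
by apply: leq_ltn_trans ni (ltn_trans (ltnSn i) _); rewrite ltn_expl ?prime_gt1.
Qed.

Definition good_count (q D m : nat) :=
  \sum_(j < D) good_digit q ((m %/ q ^ j) %% q).

Lemma sum_pairs n (F : nat -> nat) :
  \sum_(i < n.*2) F i = \sum_(j < n) (F j.*2 + F j.*2.+1).
Proof.
elim: n => [|n IH]; first by rewrite !big_ord0.
by rewrite doubleS !big_ord_recr /= IH addnA.
Qed.

Lemma logn_fact_mul_le p t m k D : prime p -> k.*2 <= 2 ^ t ->
  (p <= 2 ^ t -> 3 * t <= good_count (p ^ 2) D m) ->
  logn p (m`! * (m + k)`!) <= logn p (m.*2`! * k`!).
Proof.
move=> pp kt hgood; have p1 := prime_gt1 pp; have p0 := prime_gt0 pp.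
have pX0 i : 0 < p ^ i by rewrite expn_gt0 p0.
(* The range [n.*2] is even, for the pairing of exponents, and bounds all four arguments; [n] is
   also at least [D] and [t]. *)
rewrite !lognM ?fact_gt0 //; set n := m.*2 + k + D + t.
have leE x : x <= m.*2 + k -> x <= n.*2 by rewrite /n; lia.
rewrite !(@logn_fact_sum p _ n.*2) //; try (apply: leE; lia).
rewrite -!big_split /=.
have [pt|pt] := leqP p (2 ^ t); last first.
  apply: leq_sum => i _; apply: div_no_carry_le.
  apply: leq_ltn_trans kt (leq_trans pt _).
  by rewrite -[leqLHS]expn1 leq_pexp2l.
set L := fun i => m %/ p ^ i.+1 + (m + k) %/ p ^ i.+1.
set U := fun i => m.*2 %/ p ^ i.+1 + k %/ p ^ i.+1.
rewrite (sum_pairs n L) (sum_pairs n U).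
set g := fun j => nat_of_bool
  (good_digit (p ^ 2) ((m %/ (p ^ 2) ^ j) %% p ^ 2)).
have gsum : 3 * t <= \sum_(j < n | j < D) g j.
  rewrite -(big_ord_widen n g); first exact: hgood.
  by rewrite /n; lia.
have tsum : \sum_(j < n | j < t) 3 = 3 * t.
  rewrite -(big_ord_widen n (fun=> 3)); last by rewrite /n; lia.
  by rewrite sum_nat_const card_ord mulnC.
(* Exponents are paired as [2j+1, 2j+2]; each pair with [j < t] loses at most 2
   carries, and 3 also pays for its possibly useless good digit. *)
rewrite -(leq_add2r (3 * t)) -{2}tsum (big_mkcond (fun j : 'I_n => j < t)) /=.
apply: leq_trans (leq_add (leqnn _) gsum) _.
rewrite (big_mkcond (fun j : 'I_n => j < D)) /= -!big_split /=.
apply: leq_sum => j _; rewrite /L /U.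
have [jt|tj] := ltnP j t.
  have add3 A1 A2 B1 B2 c : A1 <= B1 + 1 -> A2 <= B2 + 1 -> c <= 1 ->
      A1 + A2 + c <= B1 + B2 + 3 by clear; lia.
  apply: add3; try exact: div_carry_le.
  by case: ifP => // _; apply: leq_b1.
have big i : t <= i -> 2 ^ t <= p ^ i.
  move=> ti; apply: leq_trans (leq_pexp2l _ ti) _ => //.
  by case: (i) => // i'; rewrite leq_exp2r.
have h1 : k.*2 < p ^ j.*2.+1.
  by apply: leq_ltn_trans kt (leq_ltn_trans (big j.*2 _) _);
    [lia | rewrite ltn_exp2l].
have h2 : k.*2 < p ^ j.*2.+2.
  by apply: ltn_trans h1 _; rewrite ltn_exp2l.
have l2 := div_no_carry_le m h2; have l1 := div_no_carry_le m h1.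
suff : m %/ p ^ j.*2.+2 + (m + k) %/ p ^ j.*2.+2 + g j
     <= m.*2 %/ p ^ j.*2.+2 + k %/ p ^ j.*2.+2.
  move=> l2'; rewrite addn0 -addnA; apply: leq_add l1 (leq_trans _ l2').
  by case: ifP; rewrite ?addn0 ?leq_addr.
rewrite /g; case: (boolP (good_digit _ _)) => gd /=; last by rewrite addn0.
(* Digit [j] in base [p ^ 2] governs the exponent [2j + 2]; [t <= j] gives [k <= (p ^ 2) ^ j]. *)
have -> : p ^ j.*2.+2 = (p ^ 2) ^ j * p ^ 2.
  by rewrite -expnM -expnD -muln2; congr expn; lia.
rewrite addn1; apply: div_good_digit_lt gd; rewrite ?expn_gt0 ?p0 //.
rewrite -expnM mul2n; apply: leq_trans (leq_trans kt _).
  by rewrite -addnn leq_addr.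
by apply: big; rewrite -addnn (leq_trans tj) ?leq_addr.
Qed.

Lemma fact_mul_dvd t m k D : k.*2 <= 2 ^ t ->
  (forall p, prime p -> p <= 2 ^ t -> 3 * t <= good_count (p ^ 2) D m) ->
  m`! * (m + k)`! %| m.*2`! * k`!.
Proof.
move=> kt hgood; have gt0 a b : 0 < a`! * b`! by rewrite muln_gt0 !fact_gt0.
apply/dvdn_partP => // p /[!mem_primes] /and3P[pp _ _].
rewrite p_part pfactor_dvdn //; exact: logn_fact_mul_le pp kt (hgood p pp).
Qed.

(** * Exponential moments of digit counts *)

Definition bad_count (q D m : nat) :=
  \sum_(j < D) ~~ good_digit q ((m %/ q ^ j) %% q).

Lemma good_bad_count q D m : good_count q D m + bad_count q D m = D.
Proof.
rewrite -big_split /= -[RHS]card_ord -sum1_card; apply: eq_bigr => j _.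
by case: good_digit.
Qed.

Lemma sum_divmod a q (f g : nat -> nat) : 0 < q ->
  \sum_(0 <= m < a * q) f (m %% q) * g (m %/ q) =
  (\sum_(0 <= x < q) f x) * (\sum_(0 <= y < a) g y).
Proof.
move=> q0; rewrite big_nat_mul big_distrr /=; apply: eq_big_nat => i _.
rewrite mulSn addnC -{1}[i * q]add0n big_addn addKn big_distrl /=.
apply: eq_big_nat => x /andP[_ xq].
by rewrite addnC modnMDl divnMDl // modn_small // divn_small // addn0.
Qed.

Lemma bad_countS q D m :
  bad_count q D.+1 m = ~~ good_digit q (m %% q) + bad_count q D (m %/ q).
Proof.
rewrite /bad_count big_ord_recl expn0 divn1; congr addn.
by apply: eq_bigr => j _; rewrite /= /bump add1n expnS divnMA.
Qed.

(** Over full blocks of length [q ^ D] the digits are independent, so the moment factors, lowest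
    digit first. *)
Lemma sum_exp_bad q D c : 0 < q ->
  \sum_(0 <= m < c * q ^ D) 2 ^ bad_count q D m =
  c * (\sum_(0 <= x < q) 2 ^ (~~ good_digit q x)) ^ D.
Proof.
move=> q0; elim: D => [|D IH].
  rewrite !muln1 -[RHS]muln1 -[in RHS](subn0 c) -sum_nat_const_nat.
  by apply: eq_big_nat => m _; rewrite /bad_count big_ord0.
under eq_big_nat do rewrite bad_countS expnD.
rewrite expnSr mulnA (sum_divmod _ (fun x => 2 ^ (~~ good_digit q x))
  (fun y => 2 ^ bad_count q D y)) // IH expnS.
by rewrite mulnCA.
Qed.

(** At least a quarter of the digits, those from [uphalf q] to [q - 2], weigh 1 instead of 2. This
    fails for [q = 5], hence the case split. *)
Lemma sum_digit_weight p : 1 < p ->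
  4 * (\sum_(0 <= x < p ^ 2) 2 ^ (~~ good_digit (p ^ 2) x)) <= 7 * p ^ 2.
Proof.
move=> p1; have : p ^ 2 = 4 \/ 6 <= p ^ 2.
  by case: p p1 => [|[|[|p]]] // _; [left | right; rewrite expnS expn1; nia].
move: (p ^ 2) => q hq; set h := uphalf q.
have hq2 : h <= q.-1 /\ q.-1 <= q /\ q <= h.*2 <= q.+1.
  by rewrite /h; move: (odd_double_half q) (uphalf_half q); case: odd; lia.
rewrite (@big_cat_nat _ _ _ h) /=; [|lia|lia].
rewrite (@big_cat_nat _ _ _ q.-1 h q) /=; [|lia|lia].
have le1 a b : \sum_(a <= x < b) 2 ^ (~~ good_digit q x) <= (b - a) * 2.
  by rewrite -sum_nat_const_nat; apply: leq_sum => x _; case: good_digit.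
have le2 : \sum_(h <= x < q.-1) 2 ^ (~~ good_digit q x) = (q.-1 - h) * 1.
  rewrite -sum_nat_const_nat; apply: eq_big_nat => x xq.
  by have -> : good_digit q x by apply/andP; lia.
have := le1 0 h; have := le1 q.-1 q; rewrite le2.
move: (\sum_(_ <= _ < _) _) (\sum_(_ <= _ < _) _); lia.
Qed.

Lemma sum_few_good p D s b : 1 < p -> (p ^ 2) ^ D <= 2 ^ s ->
  8 ^ D * (\sum_(0 <= m < 2 ^ s.+1) (good_count (p ^ 2) D m < b)) <=
  7 ^ D * 2 ^ (b + s.+2).
Proof.
move=> p1 qs; have := sum_digit_weight p1.
have q0 : 0 < p ^ 2 by rewrite expn_gt0 ltnW.
move: (p ^ 2) q0 qs => q q0 qs wq; have qD0 : 0 < q ^ D by rewrite expn_gt0 q0.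
(* [c] blocks of length [q ^ D] cover the range and overshoot by at most one block, which [qs]
   bounds. *)
set c := (2 ^ s.+1 %/ q ^ D).+1.
have lec : 2 ^ s.+1 <= c * q ^ D by rewrite ltnW // ltn_ceil.
have cle : c * q ^ D <= 2 ^ s.+2.
  rewrite mulSn (expnS 2 s.+1) mul2n -addnn leq_add ?leq_divM //.
  by apply: leq_trans qs _; rewrite leq_exp2l.
(* Markov's inequality applied to [2 ^ bad_count]. *)
have markov m : 2 ^ D * (good_count q D m < b) <= 2 ^ b * 2 ^ bad_count q D m.
  case: ltnP => gb; rewrite ?muln0 // muln1 -expnD leq_exp2l //.
  by rewrite -{1}(good_bad_count q D m) leq_add2r ltnW.
have step : 2 ^ D * (\sum_(0 <= m < 2 ^ s.+1) (good_count q D m < b)) <=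
    2 ^ b * (c * (\sum_(0 <= x < q) 2 ^ (~~ good_digit q x)) ^ D).
  rewrite -sum_exp_bad // !big_distrr /=.
  rewrite [leqRHS](big_cat_nat _ lec) //=; apply: leq_trans (leq_addr _ _).
  by apply: leq_sum => m _; apply: markov.
(* The factor 2 is spent on Markov, the factor 4 on the mean digit weight 7/4. *)
rewrite -[8]/(4 * 2) expnMn -mulnA; apply: leq_trans (leq_mul (leqnn _) step) _.
rewrite expnD mulnCA [leqRHS]mulnCA leq_mul2l; apply/orP; right.
rewrite mulnCA -expnMn;
  apply: leq_trans (leq_mul (leqnn c) (_ : _ <= (7 * q) ^ D)) _.
  by case: (posnP D) => [->//|D0]; rewrite leq_exp2r. 
rewrite expnMn mulnCA leq_mul2l cle orbT //.
Qed.

(** * Union bound over the primes up to [2 ^ t] *)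

(** [s] is such that [(p ^ 2) ^ D <= 2 ^ s] whenever [p <= 2 ^ t]. *)
Lemma exists_good t : 0 < t -> let D := 24 * t + 12 in let s := t * 2 * D in
  exists2 m, 2 ^ s <= m < 2 ^ s.+1 &
  forall p, prime p -> p <= 2 ^ t -> 3 * t <= good_count (p ^ 2) D m.
Proof.
move=> t0 D s; pose ok m p := prime p ==> (3 * t <= good_count (p ^ 2) D m).
case: (boolP (has (fun m => all (ok m) (iota 1 (2 ^ t)))
                  (iota (2 ^ s) (2 ^ s)))).
  case/hasP => m; rewrite mem_iota addnn -mul2n -expnS => ms /allP mok.
  exists m => // p pp pt; have := mok p; rewrite /ok pp mem_iota add1n ltnS pt.
  by rewrite prime_gt0 //= => /(_ isT).
move=> /hasPn nok; exfalso.
have many : 2 ^ s <= \sum_(1 <= p < (2 ^ t).+1 | prime p)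
    \sum_(0 <= m < 2 ^ s.+1) (good_count (p ^ 2) D m < 3 * t).
  rewrite (exchange_big_nat _ _ _ _ _ prime xpredT) /=.
  rewrite (@big_cat_nat _ _ _ (2 ^ s)) //=; last by rewrite leq_exp2l.
  apply: leq_trans (leq_addl _ _).
  have e : 2 ^ s.+1 - 2 ^ s = 2 ^ s by rewrite expnS mul2n -addnn addnK.
  rewrite -[leqLHS]muln1 -[in leqLHS]e -sum_nat_const_nat.
  rewrite big_nat_cond [leqRHS]big_nat_cond; apply: leq_sum => m.
  rewrite andbT => ms; have := nok m.
  rewrite mem_iota addnn -mul2n -expnS ms => /(_ isT) /allPn[p].
  rewrite mem_iota add1n /ok negb_imply -ltnNge => pt /andP[pp gd].
  by rewrite (big_rem p) /= ?mem_index_iota // pp gd.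
have few : 8 ^ D * 2 ^ s <= 2 ^ t * (7 ^ D * 2 ^ (3 * t + s.+2)).
  apply: leq_trans (leq_mul (leqnn _) many) _; rewrite big_distrr /=.
  have e : 2 ^ t = (2 ^ t).+1 - 1 by rewrite subn1.
  rewrite [in leqRHS]e -sum_nat_const_nat.
  rewrite big_nat_cond [leqRHS]big_nat_cond big_mkcond [leqRHS]big_mkcond.
  apply: leq_sum => p _; rewrite andbT; case: ifP => //.
  case/andP=> /andP[p1 pt] pp; rewrite p1 pt /=; apply: sum_few_good.
    exact: prime_gt1.
  rewrite -expnM /s -mulnA (expnM 2 t) leq_exp2r //; last by rewrite /D; lia.
(* [4 * t + 2] collects [t] from the number of primes, [3 * t] from Markov and 2 from [s.+2]; [D] is
   six times this because [2 * 7 ^ 6 < 8 ^ 6]. *)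
have : 2 ^ (4 * t + 2) * 7 ^ D < 8 ^ D.
  have -> : D = 6 * (4 * t + 2) by rewrite /D; lia.
  rewrite !(expnM _ 6) -expnMn ltn_exp2r; last by lia.
  by rewrite -[6]/(3 * 2) !(expnM _ 3 2) -!mulnn; lia.
rewrite -(ltn_pmul2r (expn_gt0 2 s)) // ltnNge; case/negP.
apply: leq_trans few _.
rewrite mulnCA -expnD -[leqRHS]mulnA [leqRHS]mulnCA -expnD.
by rewrite leq_mul2l leq_exp2l //; apply/orP; right; lia.
Qed.

(** One [m] serves all [k], as the digit condition does not involve [k]. *)
Lemma exists_fact_mul_dvd t : 0 < t -> let s := t * 2 * (24 * t + 12) in
  exists2 m, 2 ^ s <= m < 2 ^ s.+1 &
  forall k, k.*2 <= 2 ^ t -> m`! * (m + k)`! %| m.*2`! * k`!.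
Proof.
move=> t0 s; have [m ms hm] := exists_good t0.
by exists m => // k kt; exact: fact_mul_dvd kt hm.
Qed.

(** * Choice of parameters *)

(** [k] will be of order [t ^ 2], so a cubic bound yields [k.*2 <= 2 ^ t] for large [t]. *)
Lemma cube_le_exp2 t : 10 <= t -> t ^ 3 <= 2 ^ t.
Proof.
elim: t => // t IH; rewrite leq_eqVlt ltnS => /predU1P[<-|t10].
  by rewrite -[10]/(5 * 2) expnM !expnS !expn0; lia.
apply: leq_trans (_ : 2 * t ^ 3 <= _);
  last by rewrite [leqRHS]expnS leq_mul2l IH.
by rewrite !expnS !expn0; nia.
Qed.

Lemma exponent_lt_square t :
  0 < t -> t * 2 * (24 * t + 12) < 73 * t ^ 2.
Proof. by move=> t0; rewrite -mulnn; nia. Qed.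

Local Open Scope classical_set_scope.
Local Open Scope ring_scope.

Lemma finite_triples_bounded (A : set (nat * nat * nat)) :
  finite_set A -> exists N, forall a b n, A (a, b, n) -> (n <= N)%N.
Proof.
move=> /finite_seqP[l ->]; exists (\max_(x <- l) x.2)%N => a b n /= h.
exact: (@leq_bigmax_seq _ l xpredT (fun x => x.2) (a, b, n) h isT).
Qed.

Lemma exists_nat_ge (R : realType) (x : R) (N : nat) : 0 <= x ->
  exists t : nat, (N <= t)%N /\ x < t%:R.
Proof.
move=> x0; exists (N + (Num.trunc x).+1)%N; split; first exact: leq_addr.
by rewrite natrD (lt_le_trans (truncnS_gt x)) // lerDr.
Qed.

Theorem theorem1 (R : realType) (C1 C2 eps : R)
    (hC1 : 0 < C1) (hC12 : C1 < C2) (heps0 : 0 < eps) (heps1 : eps < 1 / 2) :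
  infinite_set [set t : nat * nat * nat | let: (a, b, n) := t in
    [/\ eps * n%:R <= a%:R <= (1 - eps) * n%:R,
        eps * n%:R <= b%:R <= (1 - eps) * n%:R,
        (a`! * b`! %| n`! * (a + b - n)`!)%N &
        C1 * ln n%:R < a%:R + b%:R - n%:R < C2 * ln n%:R]].
Proof.
move=> /finite_triples_bounded[N hN].
set L : R := ln 2; have L0 : 0 < L by apply: ln_gt0; lra.
have C20 : 0 < C2 by lra.
(* Thresholds for [t]: beyond [x1] the window for [k] contains an integer, beyond [x2] it gives
   [k.*2 <= 2 ^ t], beyond [x3] the bound [k * t <= m] gives [k <= (1 - 2 * eps) * m]. *)
set x1 := (C1 * L + 1) / ((C2 - C1) * L).
set x2 := 73 * (2 * C2 * L).
set x3 := (1 - 2 * eps)^-1.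
have d1 : 0 < (C2 - C1) * L by rewrite mulr_gt0 // subr_gt0.
have d3 : 0 < 1 - 2 * eps by lra.
have C1L : 0 < C1 * L by rewrite mulr_gt0.
have C2L : 0 < C2 * L by rewrite mulr_gt0.
have x10 : 0 < x1 by rewrite divr_gt0 // addr_gt0.
have x20 : 0 < x2 by rewrite /x2; lra.
have x30 : 0 < x3 by rewrite invr_gt0.
have [t [tN]] := @exists_nat_ge R (x1 + x2 + x3) (N + 10) ltac:(lra).
move=> tx.
have t1 : C1 * L + 1 < (C2 - C1) * L * t%:R.
  by rewrite -ltr_pdivrMl // mulrC -/x1; lra.
have t2 : x2 <= t%:R by lra.
have t3 : 1 <= (1 - 2 * eps) * t%:R.
  by rewrite -ler_pdivrMl // mulr1 -/x3; lra.
have t10 : (10 <= t)%N by apply: leq_trans tN; rewrite leq_addl.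
have tpos : (0 < t)%N by apply: leq_trans t10.
have [m /andP[ms1 ms2] hm] := exists_fact_mul_dvd tpos.
set s := (t * 2 * (24 * t + 12))%N in ms1 ms2.
have lnlo : L * s.+1%:R <= ln (m.*2)%:R.
  rewrite mulr_natr -lnXn ?ltr0n // -natrX ler_ln ?posrE ?ltr0n ?expn_gt0 //.
    by rewrite ler_nat expnS -mul2n leq_mul2l.
  by rewrite double_gt0 (leq_trans _ ms1) // expn_gt0.
have lnhi : ln (m.*2)%:R <= L * s.+2%:R.
  rewrite mulr_natr -lnXn ?ltr0n // -natrX ler_ln ?posrE ?ltr0n ?expn_gt0 //.
    by rewrite ler_nat expnS -mul2n leq_mul2l ltnW.
  by rewrite double_gt0 (leq_trans _ ms1) // expn_gt0.
have ts : (t + t <= s)%N.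
  by rewrite addnn -muln2 /s leq_pmulr // addn_gt0 orbT.
(* As [ln n] lies in [[L * s.+1, L * s.+2]], it suffices that [k] lies strictly between
   [C1 * L * s.+2] and [C2 * L * s.+1]. *)
set k := (Num.trunc (C1 * L * s.+2%:R)).+1.
have klo : C1 * L * s.+2%:R < k%:R by apply: truncnS_gt.
have khi : k%:R < C2 * L * s.+1%:R.
  have : (Num.trunc (C1 * L * s.+2%:R))%:R <= C1 * L * s.+2%:R.
    by rewrite truncn_le mulr_ge0 // ltW.
  have : (C2 - C1) * L * t%:R <= (C2 - C1) * L * s%:R.
    by rewrite ler_pM2l // ler_nat (leq_trans (leq_addr t t)).
  rewrite /k -(natr1 (Num.trunc _)) -(natr1 s.+1) -(natr1 s).
  lra.
have sR : s.+1%:R <= 73 * t%:R ^+ 2 :> R.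
  by rewrite -natrX -natrM ler_nat exponent_lt_square.
have kt : (k.*2 <= 2 ^ t)%N.
  apply: leq_trans (cube_le_exp2 t10).
  rewrite -(mul2n k) -(ler_nat R) natrM natrX.
  have : x2 * t%:R ^+ 2 <= t%:R ^+ 3 :> R.
    by rewrite [leRHS]exprS ler_wpM2r // exprn_ge0.
  have : C2 * L * s.+1%:R <= C2 * L * (73 * t%:R ^+ 2) by rewrite ler_pM2l.
  rewrite /x2; lra.
have kt' : (k * t <= m)%N.
  apply: leq_trans ms1; apply: leq_trans (_ : 2 ^ t * 2 ^ t <= _)%N.
    apply: leq_mul; last by rewrite ltnW // ltn_expl.
    by apply: leq_trans kt; rewrite -addnn leq_addr.
  by rewrite -expnD leq_exp2l.
(* This is exactly [b <= (1 - eps) * n] for [b = m + k] and [n = 2m]. *)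
have kR : k%:R <= (1 - 2 * eps) * m%:R :> R.
  have h : k%:R * t%:R <= m%:R :> R by rewrite -natrM ler_nat.
  apply: le_trans (_ : (1 - 2 * eps) * (k%:R * t%:R) <= _);
    last by rewrite ler_pM2l.
  by rewrite mulrCA ler_peMr.
have m0 : 0 <= m%:R :> R by [].
have k0 : 0 <= k%:R :> R by [].
have em : eps * m%:R <= 1 / 2 * m%:R by rewrite ler_wpM2r // ltW.
have mN : (m.*2 <= N)%N.
  apply: (hN m (m + k)%N) => /=; rewrite -muln2 !natrM !natrD; split.
  - by apply/andP; split; lra.
  - by apply/andP; split; lra.
  - rewrite muln2 (_ : m + (m + k) - m.*2 = k)%N.
      exact: hm.
    by rewrite addnA addnn addKn.
  rewrite (_ : _ - _ = k%:R); last by ring.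
  rewrite -natrM muln2; apply/andP; split.
    by apply: le_lt_trans klo; rewrite -mulrA ler_pM2l.
  by apply: lt_le_trans khi _; rewrite -mulrA ler_pM2l.
(* Contradiction: [N <= t < m <= m.*2 <= N]. *)
have : (t < m)%N.
  apply: leq_trans ms1; apply: leq_trans (ltn_expl t (isT : 1 < 2)%N) _.
  by rewrite leq_exp2l // (leq_trans (leq_addr t t)).
rewrite ltnNge => /negP; apply; apply: leq_trans tN.
by apply: leq_trans (leq_addr 10 N); apply: leq_trans mN;
  rewrite -addnn leq_addr.
Qed.
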